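(* Assume $\mu_k>0$ for all $1\le k\le K$. For every integer $C>0$ let $(\rho_k(C,\lambda C))_{1\le k\le K}\in\mathbb{R}_+^K$ be any solution $\rho=(\rho_k)$ of the fixed point equations with capacity $C$ and arrival rates $\lambda_kC$, $$\lambda_kC=\rho_k\left(\mu_k+\gamma_k\,\frac{\sum_{n\in\mathcal{X}_C:\,n+f_k\notin\mathcal{X}_C}\ \prod_{\ell=1}^K\rho_\ell^{n_\ell}/n_\ell!}{\sum_{n\in\mathcal{X}_C}\ \prod_{\ell=1}^K\rho_\ell^{n_\ell}/n_\ell!}\right),\qquad 1\le k\le K.$$ Then, for $1\le k\le K$, $$\lim_{C\to+\infty}\frac{\rho_k(C,\lambda C)}{C}=\frac{\lambda_k}{\mu_k+\gamma_k-\gamma_ke^{-\omega A_k}},$$ where $\omega\ge0$ is defined as $$\omega=\inf\left\{x\ge0:\ \sum_{k=1}^{K}\frac{\lambda_kA_ke^{-xA_k}}{\mu_k+\gamma_k-\gamma_ke^{-xA_k}}\le1\right\}.$$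
   Context: Fix an integer $K\ge1$, positive integers $A_1,\dots,A_K$ and rates $\lambda_k>0$, $\gamma_k>0$, $\mu_k$ for $1\le k\le K$, none of which depends on $C$. Write $\mathbb{R}_+=[0,\infty)$, let $f_k$ be the $k$th unit vector of $\mathbb{R}^K$ and, for a positive integer $C$, $$\mathcal{X}_C=\{n=(n_k)\in\mathbb{N}^K: A_1n_1+\cdots+A_Kn_K\le C\}\quad(\mathbb{N}=\{0,1,2,\dots\}).$$ *)

(* Defs.v *)
From HB Require Import structures.
From mathcomp Require Import all_boot all_order all_algebra.
From mathcomp Require Import all_classical all_reals all_analysis.
Import Order.TTheory GRing.Theory Num.Theory.
Import numFieldNormedType.Exports.

Set Implicit Arguments.
Unset Strict Implicit.
Unset Printing Implicit Defensive.

Local Open Scope classical_set_scope.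
Local Open Scope ring_scope.

Section LossNetwork.
Variables (R : realType) (K : nat) (A : 'I_K -> nat).

Definition state_space (C : nat) : set {ffun 'I_K -> nat} :=
  [set n : {ffun 'I_K -> nat} | (\sum_(k < K) A k * n k <= C)%N].

Definition unit_state (k : 'I_K) : {ffun 'I_K -> nat} :=
  [ffun l => (l == k : nat)].

Definition blocking_states (C : nat) (k : 'I_K) : set {ffun 'I_K -> nat} :=
  [set n : {ffun 'I_K -> nat} | state_space C n /\ ~ state_space C (n + unit_state k)].

Definition weight (rho : 'I_K -> R) (n : {ffun 'I_K -> nat}) : R :=
  \prod_(l < K) (rho l ^+ n l / (n l)`!%:R).

(* Both sums are [fsbigop] sums over classical sets.  They are genuine finite
   sums when every [A k] is positive, since then [state_space C] is finite;
   otherwise [\sum_(n \in _)] may take its default value 0. *)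
Definition blocking_prob (C : nat) (rho : 'I_K -> R) (k : 'I_K) : R :=
  (\sum_(n \in blocking_states C k) weight rho n) /
  (\sum_(n \in state_space C) weight rho n).

Definition fixed_point_solution (mu gamma : 'I_K -> R) (C : nat)
    (Lambda rho : 'I_K -> R) : Prop :=
  (forall k, 0 <= rho k) /\
  (forall k, Lambda k = rho k * (mu k + gamma k * blocking_prob C rho k)).

Definition omega (lambda mu gamma : 'I_K -> R) : R :=
  inf [set x : R | 0 <= x /\
    \sum_(k < K) (lambda k * (A k)%:R * expR (- (x * (A k)%:R)) /
       (mu k + gamma k - gamma k * expR (- (x * (A k)%:R)))) <= 1].

End LossNetwork.

(* Main.v *)
Require Import Defs.
From HB Require Import structures.
From mathcomp Require Import all_boot all_order all_algebra.
From mathcomp Require Import all_classical all_reals all_analysis.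
From mathcomp Require Import zify ring lra.
Import Order.TTheory GRing.Theory Num.Theory.
Import numFieldNormedType.Exports.

Set Implicit Arguments.
Unset Strict Implicit.
Unset Printing Implicit Defensive.

Local Open Scope classical_set_scope.
Local Open Scope ring_scope.

(** Write beta_k for the stationary probability that a class k call is accepted.
With S(C) the sum of the weights over the states of capacity C, shifting a
state by one class k call gives beta_k = S(C - A_k) / S(C), and the fixed point
equation becomes the exact identity

  rho_k / C = lambda_k / (mu_k + gamma_k - gamma_k beta_k).

So only the limits of the beta_k are needed, and they follow from three facts.

- A law of large numbers ([mean_difference_cvg0]): two independent stationary
  copies of n_k differ by o(C). If n_k and n'_k are far apart, replacing (n, n')
  by the midpoint state, taken twice, multiplies the product of the weights by a
  factor exponential in C, because log(j!) is convex; the midpoint is still a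
  state, and there are only polynomially many pairs of states.

- Shift rule ([shift_ratio_power]): the factorial moments of n_k are
  rho_k^m S(C - m A_k) / S(C), so by concentration S(C - m A_k) / S(C) is close
  to beta_k^m. Taking a shift by A_k A_l in two ways, beta_l^(A_k) is close to
  beta_k^(A_l): all the beta_l are asymptotically of the form x^(A_l) with a
  common x in [0, 1], depending on C ([beta_root]).

- Load balance ([load_bounds]): the mean occupied capacity divided by C is
  sum_l A_l (rho_l / C) beta_l, asymptotically [total_load] at x. It is at most
  1; and if x stays below 1, then S(C - m A_k) / S(C) is close to x^(m A_k),
  small for large m, so that almost all the mass sits near the boundary and the
  mean occupied capacity is close to C.

Since [total_load] is strictly increasing, these two bounds force x to converge
to the largest point of [0, 1] where it is at most 1, which is exp(- omega)
([total_load_cvg]). *)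

(** * Products of Poisson weights *)

(** Moving [j] units from the larger argument of a product of two factorials to the
smaller one decreases it; each unit step contributes a factor at most [q]. *)
Lemma fact_spread (R : realFieldType) (q : R) (a g j : nat) :
  (forall i, (i < j)%N -> (a + i).+1%:R <= q * (g + i).+1%:R) ->
  0 <= q ->
  (a + j)`!%:R * g`!%:R <= q ^+ j * (a`!%:R * (g + j)`!%:R).
Proof.
move=> H q0; elim: j H => [|j IH] H; first by rewrite !addn0 expr0 mul1r.
rewrite !addnS !factS !natrM exprS.
have {}IH := IH (fun i ij => H i (ltnW ij)).
have Hj := H j (leqnn _).
rewrite -mulrA.
rewrite [leRHS](_ : _ = (q * (g + j).+1%:R) *
   (q ^+ j * (a`!%:R * (g + j)`!%:R))); last by ring.
by apply: ler_pM => //; rewrite ?mulr_ge0 ?ler0n.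
Qed.

Definition poisson_term (R : realFieldType) (r : R) (a : nat) : R :=
  r ^+ a / a`!%:R.

Lemma poisson_term_ge0 (R : realFieldType) (r : R) a :
  0 <= r -> 0 <= poisson_term r a.
Proof. by move=> r0; rewrite divr_ge0 ?exprn_ge0 ?ler0n. Qed.

(** Moving [a] and [b] to their midpoint never loses more than the factor
[1 + r], which pays for rounding down when [a + b] is odd. If they are [4 * d]
apart, each of the first [d] unit steps towards the midpoint moreover gains a
factor [1 - 2 * d / C], as the two points are still at least [2 * d] apart. *)
Lemma poisson_term_mid (R : realFieldType) (r : R) (a b d C : nat) :
  0 <= r -> (a + 4 * d <= b)%N -> (b <= C)%N ->
  poisson_term r a * poisson_term r b <=
  (1 - 2 * d%:R / C%:R) ^+ d * (1 + r) * poisson_term r (a + b)./2 ^+ 2.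
Proof.
move=> r0 abd bC; set q := 1 - _.
have [C0|C0] := posnP C.
  have -> : d = 0%N by lia.
  have -> : b = 0%N by lia.
  have -> : a = 0%N by lia.
  rewrite /poisson_term /= !expr0 fact0 !divr1 expr1n !mulr1 mul1r; lra.
have C0R : 0 < C%:R :> R by rewrite ltr0n.
have q0 : 0 <= q.
  rewrite /q subr_ge0 ler_pdivrMr // mul1r -natrM ler_nat; lia.
pose g := (b - d)%N; pose a1 := (a + d)%N.
pose f := (a + b)./2; pose h := (a + b - f)%N.
have hf : h = f \/ h = f.+1 by rewrite /h /f; lia.
have E1 : a1`!%:R * g`!%:R <= q ^+ d * (a`!%:R * b`!%:R) :> R.
  have -> : b = (g + d)%N by rewrite /g; lia.
  apply: fact_spread => // i id.
  rewrite /q mulrBl mul1r lerBrDr -lerBrDl mulrAC ler_pdivrMr //.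
  rewrite -natrB -?natrM ?ler_nat; last by rewrite /g; lia.
  have : ((g + i).+1 <= C)%N by rewrite /g; lia.
  have : (2 * d <= (g + i).+1 - (a + i).+1)%N by rewrite /g; lia.
  by move=> H1 H2; apply: leq_mul.
have E2 : f`!%:R * h`!%:R <= a1`!%:R * g`!%:R :> R.
  have fa : f = (a1 + (f - a1))%N by rewrite /f /a1; lia.
  have gh : g = (h + (f - a1))%N by rewrite /g /h /f /a1; lia.
  have := @fact_spread R 1 a1 h (f - a1); rewrite -fa -gh expr1n mul1r; apply=> //.
  move=> i _; rewrite mul1r ler_nat; rewrite /h /f /a1; lia.
have E : f`!%:R * h`!%:R <= q ^+ d * (a`!%:R * b`!%:R) :> R := le_trans E2 E1.
have F0 n : 0 < n`!%:R :> R by rewrite ltr0n fact_gt0.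
have L : poisson_term r a * poisson_term r b <=
    q ^+ d * (r ^+ (f + h) / (f`!%:R * h`!%:R)).
  have -> : (f + h = a + b)%N by rewrite /h /f; lia.
  rewrite exprD /poisson_term mulf_div mulrCA ler_wpM2l ?mulr_ge0 ?exprn_ge0 //.
  rewrite ler_pdivlMr ?mulr_gt0 // mulrC ler_pdivrMr ?mulr_gt0 //.
apply: le_trans L _; rewrite -mulrA ler_wpM2l ?exprn_ge0 //.
have p0 := poisson_term_ge0 f r0.
case: hf => ->.
  rewrite exprD -mulf_div -/(poisson_term r f) -expr2.
  rewrite ler_peMl ?sqr_ge0 //; lra.
rewrite addnS exprS exprD factS natrM.
rewrite (_ : _ / _ = r / (f.+1)%:R * poisson_term r f ^+ 2); last first.
  rewrite /poisson_term; have := F0 f; have := ltr0Sn R f.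
  by rewrite -natr1 => *; field; rewrite !gt_eqF.
rewrite ler_wpM2r ?sqr_ge0 // ler_pdivrMr ?ltr0n //.
rewrite -natr1; have : 0 <= f%:R :> R by [].
nra.
Qed.

(** * The state space and its partition sums *)

Section States.
Variables (K : nat) (A : 'I_K -> nat).
Hypothesis hA : forall k, (0 < A k)%N.

Definition load (n : {ffun 'I_K -> nat}) : nat := (\sum_(k < K) A k * n k)%N.

Definition nat_config C (f : {ffun 'I_K -> 'I_C.+1}) : {ffun 'I_K -> nat} :=
  [ffun l => f l : nat].

(** A duplicate-free enumeration of [state_space A C]: every coordinate of a state
is at most [C], as the [A k] are positive. *)
Definition states (C : nat) : seq {ffun 'I_K -> nat} :=
  [seq n <- [seq @nat_config C f | f : {ffun 'I_K -> 'I_C.+1}] | (load n <= C)%N].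

Lemma states_uniq C : uniq (states C).
Proof.
rewrite filter_uniq // map_inj_uniq ?enum_uniq // => f g /ffunP fg.
by apply/ffunP => l; apply: val_inj; have := fg l; rewrite !ffunE.
Qed.

Lemma leq_load (n : {ffun _}) k : (n k <= load n)%N.
Proof. by rewrite /load (bigD1 k) //=; have := hA k; nia. Qed.

Lemma mem_states C n : (n \in states C) = (load n <= C)%N.
Proof.
rewrite mem_filter; case: leqP => //= nC.
apply/mapP; exists [ffun l => inord (n l)]; first by rewrite mem_enum.
apply/ffunP => l; rewrite !ffunE inordK // ltnS.
exact: leq_trans (leq_load n l) nC.
Qed.

Lemma size_states C : (size (states C) <= C.+1 ^ K)%N.
Proof.
rewrite size_filter (leq_trans (count_size _ _)) // size_map -cardE.
by rewrite card_ffun !card_ord.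
Qed.

Lemma load_unit (n : {ffun _}) k : load (n + unit_state k) = (load n + A k)%N.
Proof.
rewrite /load (eq_bigr (fun l => A l * n l + A l * (l == k))%N); last first.
  by move=> l _; rewrite !ffunE mulnDr.
rewrite big_split /=; congr (_ + _)%N.
rewrite (bigD1 k) //= eqxx muln1 big1 ?addn0 // => l /negPf ->.
by rewrite muln0.
Qed.

(** Adding a class [k] call is a bijection between the states with [A k] free
units and those holding a class [k] call; the moments of [n k] come from it. *)
Lemma states_occupied C k : (A k <= C)%N ->
  perm_eq [seq n : {ffun 'I_K -> nat} <- states C | (0 < n k)%N]
    [seq n + unit_state k | n <- states (C - A k)].
Proof.
move=> AC; apply: uniq_perm.
- by rewrite filter_uniq ?states_uniq.
- rewrite map_inj_uniq ?states_uniq // => n n' /ffunP nn'.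
  by apply/ffunP => l; have := nn' l; rewrite !ffunE => /addIn.
move=> n; rewrite mem_filter mem_states; apply/andP/mapP => [[nk nC]|[n' + ->]].
  have E : n = [ffun l => (n l - (l == k))%N] + unit_state k.
    apply/ffunP => l; rewrite !ffunE /=.
    rewrite -[RHS]/(n l - (l == k) + (l == k))%N subnK //.
    by case: eqVneq => // ->.
  exists [ffun l => (n l - (l == k))%N] => //.
  by move: nC; rewrite mem_states {1}E load_unit; lia.
rewrite mem_states load_unit !ffunE eqxx => H; split; last by lia.
exact: leq_addl.
Qed.

Section Weights.
Variable (R : realType) (rho : 'I_K -> R).
Hypothesis rho0 : forall k, 0 <= rho k.

Definition partition_sum (C : nat) : R := \sum_(n <- states C) weight rho n.

Lemma weight_ge0 n : 0 <= weight rho n.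
Proof. by apply: prodr_ge0 => l _; apply: poisson_term_ge0. Qed.

Lemma weight_unit (n : {ffun _}) k :
  (n k).+1%:R * weight rho (n + unit_state k) = rho k * weight rho n.
Proof.
rewrite /weight (bigD1 k) //= [in RHS](bigD1 k) //= !ffunE eqxx [(_ + _)%R]addn1.
rewrite (eq_bigr (fun l => rho l ^+ n l / (n l)`!%:R)); last first.
  by move=> l /negPf lk; rewrite !ffunE lk addr0.
rewrite !mulrA; congr (_ * _); rewrite exprS factS natrM.
field.
by rewrite pnatr_eq0 -lt0n fact_gt0 addrC natr1 pnatr_eq0.
Qed.

Lemma partition_sum_gt0 C : 0 < partition_sum C.
Proof.
have m0 : 0 \in states C.
  by rewrite mem_states /load big1 // => l _; rewrite ffunE muln0.
rewrite /partition_sum (big_rem 0) //= ltr_wpDr //.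
  by apply: sumr_ge0 => *; apply: weight_ge0.
rewrite /weight big1 ?ltr01 // => l _.
by rewrite ffunE expr0 fact0 divr1.
Qed.

Lemma sum_state_space (F : {ffun 'I_K -> nat} -> R) C :
  \sum_(n \in state_space A C) F n = \sum_(n <- states C) F n.
Proof.
rewrite [RHS]fsbig_seq ?states_uniq //.
suff -> : state_space A C = [set` states C] by [].
by apply/seteqP; split => n /=; rewrite mem_states.
Qed.

(** The Palm (Mecke) identity of the truncated Poisson distribution. *)
Lemma sum_states_occupied (h : {ffun 'I_K -> nat} -> R) C k : (A k <= C)%N ->
  \sum_(n <- states C) (n k)%:R * h n * weight rho n =
  rho k * \sum_(n <- states (C - A k)) h (n + unit_state k) * weight rho n.
Proof.
move=> AC; rewrite (bigID (fun n : {ffun 'I_K -> nat} => 0 < n k)%N) /=.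
rewrite [X in _ + X]big1 ?addr0; last first.
  by move=> n; rewrite -eqn0Ngt => /eqP ->; rewrite !mul0r.
rewrite -big_filter (perm_big _ (states_occupied AC)) big_map mulr_sumr.
apply: eq_bigr => n _; rewrite mulrAC !ffunE eqxx [(_ + _)%R]addn1 weight_unit; ring.
Qed.

Lemma factorial_moment C k m : (m * A k <= C)%N ->
  \sum_(n <- states C) ((n k) ^_ m)%:R * weight rho n =
  rho k ^+ m * partition_sum (C - m * A k).
Proof.
elim: m C => [|m IH] C mC.
  rewrite mul0n subn0 expr0 mul1r.
  by apply: eq_bigr => n _; rewrite ffactn0 mul1r.
have AC : (A k <= C)%N by rewrite (leq_trans _ mC) // mulSn leq_addr.
under eq_bigr => n _ do rewrite ffactnS natrM.
rewrite (sum_states_occupied (fun n => ((n k).-1 ^_ m)%:R)) // exprS -mulrA.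
congr (_ * _); rewrite mulSn subnDA -IH; last by rewrite leq_subRL // -mulSn.
by apply: eq_bigr => n _; rewrite !ffunE eqxx [(_ + _)%R]addn1.
Qed.

Lemma sum_states_sub (F : {ffun 'I_K -> nat} -> R) C L :
  \sum_(n <- states C | (load n <= C - L)%N) F n =
  \sum_(n <- states (C - L)) F n.
Proof.
rewrite -big_filter; apply: perm_big; apply: uniq_perm.
- by rewrite filter_uniq ?states_uniq.
- exact: states_uniq.
by move=> n; rewrite mem_filter !mem_states; lia.
Qed.

Lemma partition_sumB C L : partition_sum C - partition_sum (C - L) =
  \sum_(n <- states C | ~~ (load n <= C - L)%N) weight rho n.
Proof.
rewrite /partition_sum [X in X - _](bigID (fun n => load n <= C - L)%N) /=.
by rewrite sum_states_sub addrAC subrr add0r.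
Qed.

(** A state is not blocked for class [k] exactly when it is a state of
capacity [C - A k]. *)
Lemma blocking_probE C k : (A k <= C)%N ->
  blocking_prob A C rho k = 1 - partition_sum (C - A k) / partition_sum C.
Proof.
move=> AC; rewrite /blocking_prob sum_state_space -/(partition_sum C).
have S0 := partition_sum_gt0 C.
rewrite -[1](@divff _ (partition_sum C)) ?gt_eqF // -mulrBl; congr (_ / _).
have -> : blocking_states A C k =
    [set` [seq n <- states C | ~~ (load n <= C - A k)%N]].
  apply/seteqP; split => n /=; rewrite mem_filter mem_states.
    case=> H1 H2; rewrite [X in _ && X]H1 andbT; apply/negP => H3; apply: H2.
    by rewrite /state_space /= -/(load _) load_unit; lia.
  case/andP => H1 H2; split => // H3; move: H1.
  by move: H3; rewrite /state_space /= -/(load _) load_unit; lia.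
rewrite -fsbig_seq; last by rewrite filter_uniq ?states_uniq.
by rewrite big_filter partition_sumB.
Qed.

End Weights.
End States.

(** * Concentration of the stationary distribution *)

Section Concentration.
Variables (K : nat) (A : 'I_K -> nat).
Hypothesis hA : forall k, (0 < A k)%N.
Variable (R : realType) (rho : 'I_K -> R).
Hypothesis rho0 : forall k, 0 <= rho k.

Local Notation S := (partition_sum A rho).
Local Notation w := (weight rho).

Lemma mean_loadE C : (forall k, (A k <= C)%N) ->
  \sum_(n <- states A C) (load A n)%:R * w n =
  \sum_k (A k)%:R * (rho k * S (C - A k)).
Proof.
move=> AC.
under eq_bigr => n _ do rewrite /load natr_sum mulr_suml.
rewrite exchange_big /=; apply: eq_bigr => k _.
have := factorial_moment hA rho (C := C) (k := k) (m := 1).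
rewrite mul1n expr1 => <- //; rewrite mulr_sumr; apply: eq_bigr => n _.
by rewrite ffactn1 natrM mulrA.
Qed.

Lemma mean_load_le C :
  \sum_(n <- states A C) (load A n)%:R * w n <= C%:R * S C.
Proof.
rewrite /partition_sum mulr_sumr big_seq [leRHS]big_seq; apply: ler_sum => n.
by rewrite mem_states // => nC; rewrite ler_wpM2r ?weight_ge0 ?ler_nat.
Qed.

(** Markov's inequality: at least [C - L] units are occupied outside the states of
capacity [C - L]. *)
Lemma mean_load_ge C L : (L <= C)%N ->
  (C - L)%:R * (S C - S (C - L)) <= \sum_(n <- states A C) (load A n)%:R * w n.
Proof.
move=> LC; rewrite partition_sumB //.
rewrite [leRHS](bigID (fun n => load A n <= C - L)%N) /= ler_wpDl //.
  by apply: sumr_ge0 => n _; rewrite mulr_ge0 ?weight_ge0.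
rewrite mulr_sumr; apply: ler_sum => n; rewrite -ltnNge => nL.
by rewrite ler_wpM2r ?weight_ge0 ?ler_nat // ltnW.
Qed.

Definition midpoint (n n' : {ffun 'I_K -> nat}) : {ffun 'I_K -> nat} :=
  [ffun l => (n l + n' l)%N./2].

Lemma midpoint_states C (n n' : {ffun 'I_K -> nat}) :
  n \in states A C -> n' \in states A C ->
  midpoint n n' \in states A C.
Proof.
rewrite !mem_states // => nC nC'.
suff : (2 * load A (midpoint n n') <= load A n + load A n')%N by lia.
rewrite /load big_distrr -big_split /=; apply: leq_sum => l _.
rewrite ffunE -mulnDr mulnCA leq_mul2l; apply/orP; right; lia.
Qed.

(** The exchange argument: a pair of states that are far apart in class [k] has a
much smaller weight than its midpoint taken twice. *)
Lemma far_pair_weight C (k : 'I_K) d (M : R) (n n' : {ffun 'I_K -> nat}) :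
  (forall l, rho l <= M) ->
  n \in states A C -> n' \in states A C -> (n k + 4 * d <= n' k)%N ->
  w n * w n' <=
  (1 + M) ^+ K * `|1 - 2 * d%:R / C%:R| ^+ d * w (midpoint n n') ^+ 2.
Proof.
move=> rhoM nC nC' far; rewrite /weight -big_split /=.
have q0 : 0 <= 1 - 2 * d%:R / C%:R :> R.
  have := leq_load hA n' k; move: nC'; rewrite mem_states // => H1 H2.
  have [->|C0] := posnP C; first by rewrite invr0 mulr0 subr0.
  rewrite subr_ge0 ler_pdivrMr ?ltr0n // mul1r -natrM ler_nat.
  by have := leq_trans far (leq_trans H2 H1); lia.
have leC m l : m \in states A C -> (m l <= C)%N.
  by rewrite mem_states // => H; apply: leq_trans (leq_load hA m l) H.
rewrite ger0_norm // [X in X * _]mulrC.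
(* Only the coordinate [k] brings the exponential gain. *)
pose c l := (if l == k then (1 - 2 * d%:R / C%:R) ^+ d else 1) * (1 + M).
apply: (@le_trans _ _ (\prod_l (c l * poisson_term (rho l) (midpoint n n' l) ^+ 2))).
  apply: ler_prod => l _; rewrite mulr_ge0 ?poisson_term_ge0 //=.
  have M1 : 1 + rho l <= 1 + M by rewrite lerD2l.
  have r1 : 0 <= 1 + rho l by rewrite addr_ge0.
  rewrite /c !ffunE; case: eqVneq => [->|lk].
    apply: le_trans (poisson_term_mid (rho0 k) far (leC _ _ nC')) _.
    by rewrite ler_wpM2r ?sqr_ge0 // ler_wpM2l ?exprn_ge0 // lerD2l.
  have near a b : (a <= b <= C)%N -> poisson_term (rho l) a * poisson_term (rho l) b
      <= 1 * (1 + M) * poisson_term (rho l) (a + b)./2 ^+ 2.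
    case/andP => ab bC.
    have ab0 : (a + 4 * 0 <= b)%N by rewrite muln0 addn0.
    apply: le_trans (poisson_term_mid (rho0 l) ab0 bC) _.
    by rewrite expr0 ler_wpM2r ?sqr_ge0 // ler_wpM2l.
  case/orP: (leq_total (n l) (n' l)) => ll.
    by apply: near; rewrite ll leC.
  by rewrite mulrC addnC; apply: near; rewrite ll leC.
rewrite big_split prodrXl big_split /= -/(weight _ _).
rewrite (bigD1 k) //= eqxx [X in _ * X * _ * _]big1 => [|l /negPf -> //].
by rewrite mulr1 prodr_const card_ord lexx.
Qed.

(** Pairs at distance less than [4 * d] contribute the first term. The others
contribute at most [C] times the number of pairs times the bound of
[far_pair_weight]. *)
Lemma mean_abs_difference C (k : 'I_K) d (M : R) :
  (forall l, rho l <= M) ->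
  \sum_(n <- states A C) \sum_(n' <- states A C)
     `|(n k)%:R - (n' k)%:R| * (w n * w n') <=
  (4 * d%:R + C%:R * C.+1%:R ^+ (2 * K) * (1 + M) ^+ K *
     `|1 - 2 * d%:R / C%:R| ^+ d) * S C ^+ 2.
Proof.
move=> rhoM.
set B : R := (1 + M) ^+ K * `|1 - 2 * d%:R / C%:R| ^+ d.
have M0 : 0 <= 1 + M by rewrite addr_ge0 // (le_trans (rho0 k)).
have B0 : 0 <= B by rewrite mulr_ge0 ?exprn_ge0.
have wS m : m \in states A C -> w m <= S C.
  move=> mC; rewrite /partition_sum (big_rem m) //= lerDl.
  by apply: sumr_ge0 => *; apply: weight_ge0.
have leC m l : m \in states A C -> (m l <= C)%N.
  by rewrite mem_states // => H; apply: leq_trans (leq_load hA m l) H.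
have far n n' : n \in states A C -> n' \in states A C ->
    (n k + 4 * d <= n' k)%N -> w n * w n' <= B * S C ^+ 2.
  move=> nC nC' far; apply: le_trans (far_pair_weight rhoM nC nC' far) _.
  by rewrite ler_wpM2l // lerXn2r ?nnegrE ?weight_ge0
    ?(ltW (partition_sum_gt0 _ _ _)) // wS // midpoint_states.
apply: (@le_trans _ _ (\sum_(n <- states A C) \sum_(n' <- states A C)
     (4 * d%:R * (w n * w n') + C%:R * (B * S C ^+ 2)))).
  rewrite big_seq [leRHS]big_seq; apply: ler_sum => n nC.
  rewrite big_seq [leRHS]big_seq; apply: ler_sum => n' nC'.
  have ww : 0 <= w n * w n' by rewrite mulr_ge0 ?weight_ge0.
  have BS : 0 <= B * S C ^+ 2 by rewrite mulr_ge0 ?sqr_ge0.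
  have d4 : 0 <= 4 * d%:R :> R by rewrite mulr_ge0.
  have dC : `|(n k)%:R - (n' k)%:R| <= C%:R :> R.
    have := leC _ k nC; have := leC _ k nC'.
    rewrite -!(ler_nat R) ler_norml => H1 H2.
    have : 0 <= (n k)%:R :> R by [].
    have : 0 <= (n' k)%:R :> R by [].
    by move=> H3 H4; apply/andP; split; lra.
  have [f|f] := leqP (n k + 4 * d)%N (n' k).
    by apply: ler_wpDl; [rewrite mulr_ge0 | rewrite ler_pM]; rewrite // far.
  have [f'|f'] := leqP (n' k + 4 * d)%N (n k).
    by apply: ler_wpDl; [rewrite mulr_ge0 | rewrite ler_pM]; rewrite // mulrC far.
  apply: ler_wpDr; first by rewrite mulr_ge0.
  rewrite ler_wpM2r // ler_norml.
  have : (n' k)%:R < (n k)%:R + 4 * d%:R :> R by rewrite -natrM -natrD ltr_nat.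
  have : (n k)%:R < (n' k)%:R + 4 * d%:R :> R by rewrite -natrM -natrD ltr_nat.
  by move=> H1 H2; apply/andP; split; lra.
under eq_bigr => n _ do rewrite big_split /= -mulr_sumr -mulr_sumr big_const_seq
  count_predT iter_addr_0.
rewrite big_split /= -mulr_sumr -mulr_suml -/(S C) -expr2 big_const_seq.
rewrite count_predT [iter _ (+%R (_ *+ _)) _]iter_addr_0 -mulrnA [leRHS]mulrDl lerD2l.
have CB : 0 <= C%:R * (B * S C ^+ 2) by rewrite mulr_ge0 // mulr_ge0 ?sqr_ge0.
rewrite -[leLHS]mulr_natl -[C%:R * _ * _ * _]mulrA -/B.
rewrite [C%:R * C.+1%:R ^+ _]mulrC -2![leRHS]mulrA ler_wpM2r //.
by rewrite -natrX ler_nat [(2 * K)%N]mulnC expnM -mulnn leq_mul // size_states.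
Qed.

(** As [n ^_ m.+1] is [n ^_ m * n] minus [m * n ^_ m], the left-hand side is, up to
this correction, a covariance of [n k ^_ m] and [n k]; it is written with an
independent copy of [n]. *)
Lemma factorial_moment_product C (k : 'I_K) m :
  `|S C * (\sum_(n <- states A C) ((n k) ^_ m.+1)%:R * w n) -
    (\sum_(n <- states A C) ((n k) ^_ m)%:R * w n) *
    (\sum_(n <- states A C) (n k)%:R * w n)| <=
  C%:R ^+ m * (m%:R * S C ^+ 2 +
    \sum_(n <- states A C) \sum_(n' <- states A C)
     `|(n k)%:R - (n' k)%:R| * (w n * w n')).
Proof.
have fS n : (n ^_ m.+1)%:R = (n ^_ m)%:R * n%:R - m%:R * (n ^_ m)%:R :> R.
  rewrite ffactnSr natrM; have [mn|nm] := leqP m n.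
    by rewrite natrB // mulrBr [m%:R * _]mulrC.
  by rewrite ffact_small // !mul0r mulr0 subr0.
have leC n l : n \in states A C -> (n l <= C)%N.
  by rewrite mem_states // => H; apply: leq_trans (leq_load hA n l) H.
have leX n : n \in states A C -> ((n k) ^_ m)%:R <= C%:R ^+ m :> R.
  move=> nC; rewrite -natrX ler_nat ffact_prod.
  rewrite -[m in (C ^ m)%N]card_ord -prod_nat_const.
  by apply: leq_prod => i _; rewrite (leq_trans (leq_subr _ _)) // leC.
rewrite [X in `|X|](_ : _ =
   \sum_(n <- states A C) \sum_(n' <- states A C)
     ((n k) ^_ m)%:R * ((n k)%:R - (n' k)%:R - m%:R) * (w n * w n')); last first.
  rewrite [S C * _]mulrC !mulr_suml -sumrB; apply: eq_bigr => n _.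
  rewrite !mulr_sumr -sumrB; apply: eq_bigr => n' _.
  rewrite fS; ring.
rewrite mulrDr [S C ^+ 2](_ : _ =
   \sum_(n <- states A C) \sum_(n' <- states A C) w n * w n'); last first.
  by rewrite expr2 [in LHS]mulr_suml; apply: eq_bigr => n _; rewrite mulr_sumr.
rewrite !mulr_sumr -big_split /=.
apply: le_trans (ler_norm_sum _ _ _) _.
rewrite big_seq [leRHS]big_seq; apply: ler_sum => n nC.
rewrite !mulr_sumr -big_split /=.
apply: le_trans (ler_norm_sum _ _ _) _.
apply: ler_sum => n' _.
have ww : 0 <= w n * w n' by rewrite mulr_ge0 ?weight_ge0.
rewrite normrM (ger0_norm ww) normrM (ger0_norm (ler0n _ _)) -mulrDr -mulrDl mulrA.
rewrite ler_wpM2r // ler_pM // ?leX // [leRHS]addrC (le_trans (ler_normB _ _)) //.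
by rewrite lerD2l ger0_norm.
Qed.

End Concentration.

(** * Limits of sequences *)

Section Limits.
Variable R : realType.

Lemma norm_le_cvg0 (f g : nat -> R) :
  (\forall n \near \oo, `|f n| <= g n) -> g n @[n --> \oo] --> 0 ->
  f n @[n --> \oo] --> 0.
Proof.
move=> fg g0; apply: norm_cvg0; apply: (squeeze_cvgr _ (cvg_cst 0) g0).
by near=> n; rewrite normr_ge0 /=; near: n.
Unshelve. all: by end_near. Qed.

Lemma cvg_exprn (f : nat -> R) (a : R) m :
  f n @[n --> \oo] --> a -> f n ^+ m @[n --> \oo] --> a ^+ m.
Proof.
move=> fa; elim: m => [|m IH].
  by under eq_cvg do rewrite expr0; exact: cvg_cst.
by under eq_cvg do rewrite exprS; rewrite exprS; exact: cvgM.
Qed.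

Lemma cvg_sumr (I : Type) (r : seq I) (f : I -> nat -> R) (a : I -> R) :
  (forall i, f i n @[n --> \oo] --> a i) ->
  \sum_(i <- r) f i n @[n --> \oo] --> \sum_(i <- r) a i.
Proof.
move=> fa; elim: r => [|i r IH].
  by under eq_cvg do rewrite big_nil; rewrite big_nil; exact: cvg_cst.
by under eq_cvg do rewrite big_cons; rewrite big_cons; exact: cvgD.
Qed.

Lemma cvg_harmonic_scaled (c : R) : c / n.+1%:R @[n --> \oo] --> 0.
Proof.
rewrite -[X in _ --> X](mulr0 c).
by apply: cvgM; [exact: cvg_cst | exact: cvg_harmonic].
Qed.

Lemma cvg_inv_nat (c : R) : c / n%:R @[n --> \oo] --> 0.
Proof. by rewrite -cvg_shiftS; exact: cvg_harmonic_scaled. Qed.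

(** With [N' = N + 1], the exponential is at most the power [2 * N'] of one that is
itself at most a multiple of [n.+1 ^-1], which beats [n.+1 ^+ N']. *)
Lemma poly_expR_cvg0 (a : R) N : 0 < a ->
  n.+1%:R ^+ N * expR (- (a * n%:R)) @[n --> \oo] --> 0.
Proof.
move=> a0; pose N' := N.+1.
have N0 : 0 < (2 * N')%:R :> R by rewrite ltr0n.
(* [b] splits the rate [a] into [2 * N'] parts; [b <= 1] gives
   [b * n.+1 <= 1 + b * n]. *)
have [b [b0 b1 ba]] : exists b : R, [/\ 0 < b, b <= 1 & b * (2 * N')%:R <= a].
  exists (Num.min 1 (a / (2 * N')%:R)); split.
  - by rewrite lt_min ltr01 divr_gt0.
  - by rewrite ge_min lexx.
  - by rewrite -ler_pdivlMr // ge_min lexx orbT.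
pose u n : R := ((b ^+ 2)^-1 / n.+1%:R) ^+ N'.
apply: (@norm_le_cvg0 _ u); last first.
  have -> : 0 = 0 ^+ N' :> R by rewrite expr0n.
  exact/cvg_exprn/cvg_harmonic_scaled.
near=> n; have n1 : 1 <= n.+1%:R :> R by rewrite ler1n.
rewrite ger0_norm ?mulr_ge0 ?expR_ge0 ?exprn_ge0 //.
apply: (@le_trans _ _ (n.+1%:R ^+ N' * expR (- (b * n%:R)) ^+ (2 * N'))).
  apply: ler_pM; rewrite ?expR_ge0 ?exprn_ge0 //.
    by rewrite ler_weXn2l.
  rewrite -expRM_natl ler_expR mulrN lerN2 mulrA.
  by rewrite ler_wpM2r // mulrC.
rewrite /u exprM -exprMn lerXn2r ?nnegrE ?mulr_ge0 ?expR_ge0 ?exprn_ge0 //.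
  by rewrite invr_ge0 exprn_ge0 // ltW.
have E : b * n.+1%:R * expR (- (b * n%:R)) <= 1.
  rewrite expRN ler_pdivrMr ?expR_gt0 // mul1r.
  apply: le_trans (expR_ge1Dx _); rewrite -natr1 mulrDr mulr1; lra.
rewrite ler_pdivlMr ?ltr0n // -[leRHS]mul1r ler_pdivlMr ?exprn_gt0 //.
have E0 : 0 <= b * n.+1%:R * expR (- (b * n%:R)).
  by rewrite !mulr_ge0 ?expR_ge0 // ltW.
move: (expR _) (n.+1%:R : R) E E0 => e s E E0.
by rewrite (_ : _ * _ = (b * s * e) ^+ 2) ?expr_le1 //; ring.
Unshelve. all: by end_near. Qed.

(** The error term of [mean_abs_difference] vanishes at the scale [d = C %/ p]:
the gain is then exponential in [C]. *)
Lemma near_size_cvg0 (K p : nat) (c : R) : (1 < p)%N -> 1 <= c ->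
  C.+1%:R ^+ (2 * K) * (1 + c * C%:R) ^+ K *
    `|1 - 2 * (C %/ p)%:R / C%:R| ^+ (C %/ p) @[C --> \oo] --> 0.
Proof.
move=> p1 c1; have p0 : 0 < p%:R :> R by rewrite ltr0n ltnW.
pose a : R := (2 * p%:R ^+ 2)^-1.
have a0 : 0 < a by rewrite invr_gt0 mulr_gt0 ?exprn_gt0.
pose u C : R := c ^+ K * (C.+1%:R ^+ (2 * K + K) * expR (- (a * C%:R))).
apply: (@norm_le_cvg0 _ u); last first.
  rewrite -[X in _ --> X](mulr0 (c ^+ K)).
  by apply: cvgM; [exact: cvg_cst | exact: poly_expR_cvg0].
near=> C.
have C2p : (2 * p <= C)%N by near: C; apply: nbhs_infty_ge.
have C0 : 0 < C%:R :> R by rewrite ltr0n; lia.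
set d := (C %/ p)%N.
have dC : (2 * d <= C)%N.
  by rewrite (leq_trans _ (leq_trunc_div C p)) // mulnC leq_mul2l p1 orbT.
have Cd : (C <= 2 * p * d)%N.
  have d1 : (0 < d)%N.
    by rewrite divn_gt0 ?(ltnW p1) // (leq_trans _ C2p) // leq_pmull.
  rewrite -mulnA mul2n -addnn {1}(divn_eq C p) -/d [(d * p)%N]mulnC leq_add2l.
  by rewrite (leq_trans (ltnW (ltn_pmod C (ltnW p1)))) // leq_pmulr.
rewrite ger0_norm ?mulr_ge0 ?exprn_ge0 ?addr_ge0 ?mulr_ge0 //; last first.
  exact: le_trans c1.
rewrite /u exprD [leRHS]mulrA [c ^+ K * _]mulrCA -mulrA -[leRHS]mulrA.
rewrite ler_wpM2l ?exprn_ge0 // -exprMn.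
apply: ler_pM; rewrite ?exprn_ge0 ?addr_ge0 ?mulr_ge0 //.
- exact: le_trans c1.
- rewrite lerXn2r ?nnegrE ?addr_ge0 ?mulr_ge0 ?(le_trans ler01 c1) //.
  by rewrite -natr1 mulrDr mulr1 addrC lerD2l.
have q0 : 0 <= 1 - 2 * d%:R / C%:R :> R.
  by rewrite subr_ge0 ler_pdivrMr // mul1r -natrM ler_nat.
rewrite ger0_norm //.
apply: (@le_trans _ _ (expR (- (2 * d%:R / C%:R)) ^+ d)).
  by rewrite lerXn2r ?nnegrE ?expR_ge0 // expR_ge1Dx.
rewrite -expRM_natl ler_expR mulrN lerN2 /a.
rewrite mulrC ler_pdivrMr ?mulr_gt0 ?exprn_gt0 //.
have : C%:R ^+ 2 <= (2 * p%:R * d%:R) ^+ 2 :> R.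
  by rewrite lerXn2r ?nnegrE // -!natrM ler_nat.
move=> Cd2; rewrite -(ler_pM2r C0) -[leLHS]expr2 (le_trans Cd2) //.
move: (C%:R : R) (p%:R : R) (d%:R : R) C0 => c' p' d' C0.
by rewrite le_eqVlt; apply/orP; left; apply/eqP; field; rewrite gt_eqF.
Unshelve. all: by end_near. Qed.

End Limits.

(** Superadditivity of the power on nonnegative numbers; it makes [p]-th roots
uniformly continuous. *)
Lemma exprn_dist_le (R : realType) (a b : R) p : (0 < p)%N -> 0 <= a -> 0 <= b ->
  `|a - b| ^+ p <= `|a ^+ p - b ^+ p|.
Proof.
move=> p0; wlog ab : a b / b <= a.
  move=> H a0 b0; have [ba|/ltW ab] := leP b a; first exact: H.
  by rewrite -normrN opprB -[leRHS]normrN opprB; exact: H.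
move=> a0 b0; have pab : b ^+ p <= a ^+ p by rewrite lerXn2r ?nnegrE.
rewrite !ger0_norm ?subr_ge0 // lerBrDr.
have u0 : 0 <= a - b by rewrite subr_ge0.
rewrite -{2}[a](subrK b); move: (a - b) u0 => u u0.
elim: p p0 {pab} => // -[|p] IH _; first by rewrite !expr1.
apply: (@le_trans _ _ ((u + b) * (u ^+ p.+1 + b ^+ p.+1))); last first.
  by rewrite [leRHS]exprS ler_wpM2l ?addr_ge0 // IH.
rewrite !(exprS _ p.+1).
have : 0 <= u * b ^+ p.+1 by rewrite mulr_ge0 ?exprn_ge0.
have : 0 <= b * u ^+ p.+1 by rewrite mulr_ge0 ?exprn_ge0.
lra.
Qed.

Lemma cvg0_of_exprn (R : realType) (f : nat -> R) p : (0 < p)%N ->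
  `|f n| ^+ p @[n --> \oo] --> 0 -> f n @[n --> \oo] --> 0.
Proof.
move=> p0 /cvgr0Pnorm_lt H; apply/cvgr0Pnorm_lt => e e0.
have {}H := H _ (exprn_gt0 p e0).
near=> n; rewrite -(ltr_pXn2r p0) ?nnegrE ?(ltW e0) //.
by apply: le_lt_trans (ler_norm _) _; near: n.
Unshelve. all: by end_near. Qed.

Lemma near_eq_cvgn (R : realType) (f g : nat -> R) (a : R) :
  (\forall n \near \oo, f n = g n) ->
  f n @[n --> \oo] --> a -> g n @[n --> \oo] --> a.
Proof.
move=> fg; apply: cvg_trans; apply: near_eq_cvg.
by apply: filterS fg => n ->.
Qed.

(** * The law of large numbers and shifts of the capacity *)

Section LawOfLargeNumbers.
Variables (K : nat) (A : 'I_K -> nat).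
Hypothesis hA : forall k, (0 < A k)%N.
Variables (R : realType) (rho : nat -> 'I_K -> R).
Hypothesis rho0 : \forall C \near \oo, forall k, 0 <= rho C k.
Let S C := partition_sum A (rho C).
Let w C := weight (rho C).

(** For [L = A k] this is the stationary probability that a class [k] call is
accepted. *)
Definition shift_ratio C L : R := S C (C - L) / S C C.

Definition scaled_factorial_moment k m C : R :=
  (\sum_(n <- states A C) ((n k) ^_ m)%:R * w C n) / (C%:R ^+ m * S C C).

Lemma scaled_factorial_momentE k m : \forall C \near \oo,
  scaled_factorial_moment k m C =
  (rho C k / C%:R) ^+ m * shift_ratio C (m * A k).
Proof.
near=> C.
have r0 : forall k, 0 <= rho C k by near: C.
have mC : (m * A k <= C)%N by near: C; exact: nbhs_infty_ge.
rewrite /scaled_factorial_moment factorial_moment // expr_div_n -mulf_div //.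
Unshelve. all: by end_near. Qed.

Lemma shift_ratio_bounds : \forall C \near \oo, forall L,
  0 <= shift_ratio C L <= 1.
Proof.
near=> C => L.
have r0 : forall k, 0 <= rho C k by near: C.
have S0 := partition_sum_gt0 hA r0.
rewrite divr_ge0 ?(ltW (S0 _)) //= ler_pdivrMr ?S0 // mul1r.
rewrite -subr_ge0 partition_sumB // sumr_ge0 // => n _.
exact: weight_ge0.
Unshelve. all: by end_near. Qed.

Variables (c c0 : R).
Hypothesis c1 : 1 <= c.
Hypothesis rho_le : \forall C \near \oo, forall k, rho C k <= c * C%:R.
Hypothesis c0_gt0 : 0 < c0.
Hypothesis rho_ge : \forall C \near \oo, forall k, c0 * C%:R <= rho C k.

(** The mean of [|n k - n' k| / C] for two independent stationary states [n] and
[n']. *)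
Definition mean_difference k C : R :=
  (\sum_(n <- states A C) \sum_(n' <- states A C)
     `|(n k)%:R - (n' k)%:R| * (w C n * w C n')) / (C%:R * S C C ^+ 2).

Lemma mean_difference_cvg0 k : mean_difference k C @[C --> \oo] --> 0.
Proof.
apply/cvgr0Pnorm_le => /= e e0.
(* At the scale [d = C %/ p], the term [4 * d / C] is at most [e / 2]. *)
pose p := (Num.truncn (8 / e)).+2.
have pe : 4 / p%:R <= e / 2.
  rewrite ler_pdivrMr ?ltr0n // mulrAC ler_pdivlMr // mulrC -ler_pdivrMl //.
  rewrite (_ : _ * _ = 8 / e); last by field; rewrite gt_eqF.
  by apply/ltW/(lt_le_trans (truncnS_gt _)); rewrite ler_nat.
have p1 : (1 < p)%N by [].
have := near_size_cvg0 (R := R) K p1 c1.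
move=> /cvgr0Pnorm_le /(_ _ (divr_gt0 e0 (ltr0n R 2))) small.
near=> C.
have r0 : forall k, 0 <= rho C k by near: C.
have rM : forall k, rho C k <= c * C%:R by near: C.
have S0 : 0 < S C C by apply: partition_sum_gt0.
have C0 : 0 < C%:R :> R by rewrite ltr0n; near: C; exact: nbhs_infty_gt.
have CS : 0 < C%:R * S C C ^+ 2 by rewrite mulr_gt0 ?exprn_gt0.
rewrite ger0_norm; last first.
  rewrite divr_ge0 ?(ltW CS) // sumr_ge0 // => n _; rewrite sumr_ge0 // => n' _.
  by rewrite !mulr_ge0 ?weight_ge0.
rewrite ler_pdivrMr //.
apply: le_trans (mean_abs_difference hA r0 C k (C %/ p) rM) _.
rewrite [leRHS]mulrA ler_wpM2r ?sqr_ge0 //.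
rewrite [X in _ <= X * _]splitr [leRHS]mulrDl lerD //.
  rewrite (le_trans _ (ler_wpM2r (ltW C0) pe)) // mulrAC -mulrA ler_wpM2l //.
  by rewrite ler_pdivlMr ?ltr0n // -natrM ler_nat leq_trunc_div.
rewrite -[leLHS]mulrA -[leLHS]mulrA [leRHS]mulrC ler_wpM2l ?(ltW C0) // mulrA.
apply: le_trans (ler_norm _) _; near: C; exact: small.
Unshelve. all: by end_near. Qed.

(** Concentration makes [n k / C] asymptotically deterministic, so that its moments
become powers of its mean. *)
Lemma scaled_factorial_moment_cvg k m :
  scaled_factorial_moment k m C - scaled_factorial_moment k 1 C ^+ m
    @[C --> \oo] --> 0.
Proof.
pose M := scaled_factorial_moment k.
have M1 : \forall C \near \oo, `|M 1%N C| <= c.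
  near=> C.
  have C0 : 0 < C%:R :> R by rewrite ltr0n; near: C; exact: nbhs_infty_gt.
  have r0 : forall k, 0 <= rho C k by near: C.
  have rM : forall k, rho C k <= c * C%:R by near: C.
  have -> : M 1%N C = (rho C k / C%:R) ^+ 1 * shift_ratio C (1 * A k).
    by near: C; exact: scaled_factorial_momentE.
  have /andP[s0 s1] : 0 <= shift_ratio C (1 * A k) <= 1.
    by move: (1 * A k)%N; near: C; exact: shift_ratio_bounds.
  have q0 : 0 <= rho C k / C%:R by rewrite divr_ge0 // ltW.
  rewrite expr1 ger0_norm; last exact: mulr_ge0.
  rewrite -[leRHS]mulr1; apply: ler_pM => //.
  by rewrite ler_pdivrMr.
elim: m => [|m IH].
  apply: (@norm_le_cvg0 _ _ (fun=> 0)); last exact: cvg_cst.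
  near=> C; have r0 : forall k, 0 <= rho C k by near: C.
  rewrite /scaled_factorial_moment !expr0 mul1r.
  under eq_bigr => n _ do rewrite ffactn0 mul1r.
  by rewrite divff ?subrr ?normr0 // gt_eqF // partition_sum_gt0.
apply: (@norm_le_cvg0 _ _ (fun C => (m%:R / C%:R + mean_difference k C) +
    c * `|M m C - M 1%N C ^+ m|)); last first.
  rewrite -[X in _ --> X](_ : (0 + 0) + c * 0 = 0); last by rewrite mulr0 !addr0.
  apply: cvgD; first apply: cvgD; first exact: cvg_inv_nat.
    exact: mean_difference_cvg0.
  apply: cvgM; first exact: cvg_cst.
  by rewrite -[X in _ --> X](@normr0 _ R); exact: cvg_norm.
near=> C.
have r0 : forall k, 0 <= rho C k by near: C.
have S0 : 0 < S C C by apply: partition_sum_gt0.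
have C0 : 0 < C%:R :> R by rewrite ltr0n; near: C; exact: nbhs_infty_gt.
rewrite (_ : _ - _ = (M m.+1 C - M m C * M 1%N C) + M 1%N C * (M m C - M 1%N C ^+ m));
  last by rewrite exprS /M; ring.
apply: le_trans (ler_normD _ _) _; apply: lerD; last first.
  by rewrite normrM ler_wpM2r //; near: C.
have := factorial_moment_product hA r0 C k m.
have -> : M 1%N C = (\sum_(n <- states A C) (n k)%:R * w C n) / (C%:R * S C C).
  by rewrite /M /scaled_factorial_moment expr1; under eq_bigr do rewrite ffactn1.
rewrite -/(S C C) /M /scaled_factorial_moment /mean_difference (exprS _ m).
set X : R := \sum_(n <- _) _; set Y : R := \sum_(n <- _) _.
set Z : R := \sum_(n <- _) _; set D : R := \sum_(n <- _) _.
have cm0 : 0 < C%:R ^+ m :> R by rewrite exprn_gt0.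
move: (S C C) (C%:R : R) (C%:R ^+ m : R) X Y Z D S0 C0 cm0.
move=> s c' cm X Y Z D s0 c0' cm0 H.
have E : 0 < c' * cm * s ^+ 2 by rewrite !mulr_gt0 ?exprn_gt0.
rewrite -(ler_pM2r E) -{1}(ger0_norm (ltW E)) -normrM.
move: H; congr (`|_| <= _).
  by field; rewrite !gt_eqF.
by field; rewrite !gt_eqF //.
Unshelve. all: by end_near. Qed.

(** Dividing the factorial moments by powers of [rho C k / C] is harmless because
this quotient stays away from 0. *)
Lemma shift_ratio_power k m :
  shift_ratio C (m * A k) - shift_ratio C (A k) ^+ m @[C --> \oo] --> 0.
Proof.
pose M := scaled_factorial_moment k.
apply: (@norm_le_cvg0 _ _ (fun C => (c0 ^- m) * `|M m C - M 1%N C ^+ m|)).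
  near=> C.
  have r0 : forall k, 0 <= rho C k by near: C.
  have C0 : 0 < C%:R :> R by rewrite ltr0n; near: C; exact: nbhs_infty_gt.
  have rC : c0 <= rho C k / C%:R.
    have rg : forall l, c0 * C%:R <= rho C l by near: C.
    by rewrite ler_pdivlMr.
  have -> : M m C = (rho C k / C%:R) ^+ m * shift_ratio C (m * A k).
    by near: C; exact: scaled_factorial_momentE.
  have -> : M 1%N C = (rho C k / C%:R) ^+ 1 * shift_ratio C (1 * A k).
    by near: C; exact: scaled_factorial_momentE.
  move: (rho C k / C%:R) rC => q rC.
  rewrite expr1 mul1n [(q * _) ^+ m]exprMn -mulrBr normrM mulrA ler_peMl //.
  rewrite ger0_norm ?exprn_ge0 ?(le_trans (ltW c0_gt0)) //.
  rewrite mulrC ler_pdivlMr ?exprn_gt0 // mul1r.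
  by rewrite lerXn2r // ?nnegrE ?(le_trans (ltW c0_gt0)) // ltW.
rewrite -[X in _ --> X](mulr0 (c0 ^- m)).
apply: cvgM; first exact: cvg_cst.
rewrite -[X in _ --> X](@normr0 _ R); apply: cvg_norm.
exact: scaled_factorial_moment_cvg.
Unshelve. all: by end_near. Qed.

End LawOfLargeNumbers.

(** * The load as a function of the common acceptance parameter *)

Section CarriedLoad.
Variables (K : nat) (A : 'I_K -> nat).
Hypothesis hK : (1 <= K)%N.
Hypothesis hA : forall k, (0 < A k)%N.
Variables (R : realType) (lambda gamma mu : 'I_K -> R).
Hypothesis hlambda : forall k, 0 < lambda k.
Hypothesis hgamma : forall k, 0 < gamma k.
Hypothesis hmu : forall k, 0 < mu k.

Let lambda_ge0 l : 0 <= lambda l. Proof. exact/ltW. Qed.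
Let gamma_ge0 l : 0 <= gamma l. Proof. exact/ltW. Qed.
Let mu_ge0 l : 0 <= mu l. Proof. exact/ltW. Qed.

(** The share of the capacity occupied on average by class [l], when a fraction
[t] of its calls is accepted in a solution of the fixed point equations. *)
Definition class_load (l : 'I_K) (t : R) : R :=
  lambda l * (A l)%:R * t / (mu l + gamma l - gamma l * t).

Definition total_load (x : R) : R := \sum_(l < K) class_load l (x ^+ A l).

Lemma denom_ge_mu l t : t <= 1 -> mu l <= mu l + gamma l - gamma l * t.
Proof. by move=> t1; have := hgamma l; nra. Qed.

Lemma denom_gt0 l t : t <= 1 -> 0 < mu l + gamma l - gamma l * t.
Proof. by move=> /(denom_ge_mu l); apply: lt_le_trans. Qed.

Lemma class_loadB l s t : s <= 1 -> t <= 1 ->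
  class_load l t - class_load l s =
  lambda l * (A l)%:R * (mu l + gamma l) * (t - s) /
    ((mu l + gamma l - gamma l * t) * (mu l + gamma l - gamma l * s)).
Proof.
move=> s1 t1; have := denom_gt0 l s1; have := denom_gt0 l t1.
rewrite /class_load; move: (lambda l) ((A l)%:R : R) (mu l) (gamma l).
by move=> la a m g h1 h2; field; rewrite !gt_eqF.
Qed.

Lemma class_load_lt l s t : s < t -> t <= 1 -> class_load l s < class_load l t.
Proof.
move=> st t1; have s1 : s <= 1 := ltW (lt_le_trans st t1).
rewrite -subr_gt0 class_loadB // divr_gt0 ?mulr_gt0 ?denom_gt0 //.
- by rewrite ltr0n.
- by rewrite addr_gt0.
- by rewrite subr_gt0.
Qed.

Lemma class_load_lipschitz l s t : s <= 1 -> t <= 1 ->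
  `|class_load l t - class_load l s| <=
  lambda l * (A l)%:R * (mu l + gamma l) / mu l ^+ 2 * `|t - s|.
Proof.
move=> s1 t1; have d1 := denom_gt0 l s1; have d2 := denom_gt0 l t1.
have c0 : 0 <= lambda l * (A l)%:R * (mu l + gamma l).
  by rewrite !mulr_ge0 // addr_ge0.
rewrite class_loadB // normrM normfV normrM (ger0_norm c0).
rewrite (gtr0_norm (mulr_gt0 d2 d1)) [leRHS]mulrAC ler_wpM2l ?(mulr_ge0 c0) //.
rewrite lef_pV2 ?posrE ?mulr_gt0 ?exprn_gt0 // expr2.
by apply: ler_pM; rewrite ?denom_ge_mu // ltW.
Qed.

Lemma total_load_lt s t : 0 <= s -> s < t -> t <= 1 -> total_load s < total_load t.
Proof.
move=> s0 st t1; have t0 : 0 <= t := ltW (le_lt_trans s0 st).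
apply: ltr_sum => [|l _]; last first.
  by rewrite class_load_lt ?exprn_ile1 // ltrXn2r ?nnegrE // -lt0n.
by apply/hasP; exists (Ordinal hK) => //; rewrite mem_index_enum.
Qed.

Lemma total_load_le s t : 0 <= s -> s <= t -> t <= 1 -> total_load s <= total_load t.
Proof.
by move=> s0; rewrite le_eqVlt => /orP[/eqP -> //|st] t1; rewrite ltW ?total_load_lt.
Qed.

Let om := omega A lambda mu gamma.

Let admissible : set R := [set x : R | 0 <= x /\ total_load (expR (- x)) <= 1].

Lemma omegaE : om = inf admissible.
Proof.
rewrite /om /omega /admissible; congr inf; apply/seteqP.
have E (x : R) l : expR (- (x * (A l)%:R)) = expR (- x) ^+ A l.
  by rewrite -expRM_natl mulrN mulrC.
split=> x /= [x0 H]; split => //; move: H; rewrite /total_load /class_load.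
  by under eq_bigr => l _ do rewrite E.
by under [X in _ -> X <= _]eq_bigr => l _ do rewrite E.
Qed.

(** The sum [B] bounds [total_load (expR (- x))] by [B * expR (- x)], which is at
most 1 at [x = B]. *)
Lemma admissible_nonempty : admissible !=set0.
Proof.
pose B : R := \sum_(l < K) lambda l * (A l)%:R / mu l.
have B0 : 0 <= B by apply: sumr_ge0 => l _; rewrite divr_ge0 // mulr_ge0.
exists B; split=> //.
have e1 : expR (- B) <= 1 by rewrite expR_le1 oppr_le0.
have e0 := expR_gt0 (- B).
apply: (@le_trans _ _ (B * expR (- B))); last first.
  rewrite expRN ler_pdivrMr ?expR_gt0 // mul1r.
  by apply: le_trans (expR_ge1Dx B); rewrite lerDr.
rewrite /total_load /B mulr_suml; apply: ler_sum => l _.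
have eA : expR (- B) ^+ A l <= expR (- B).
  by rewrite -[leRHS]expr1 ler_wiXn2l // ?ltW.
rewrite /class_load mulrAC; apply: ler_pM => //.
- by rewrite divr_ge0 ?mulr_ge0 // ltW // denom_gt0 // (le_trans eA).
rewrite ler_wpM2l ?mulr_ge0 // lef_pV2 ?posrE ?denom_ge_mu ?denom_gt0 //.
  exact: le_trans e1.
exact: le_trans e1.
Qed.

Lemma omega_ge0 : 0 <= om.
Proof.
by rewrite omegaE; apply: lb_le_inf admissible_nonempty _ => x [].
Qed.

Lemma total_load_gt1 z : expR (- om) < z -> z <= 1 -> 1 < total_load z.
Proof.
move=> oz z1; have z0 := lt_trans (expR_gt0 _) oz.
rewrite ltNge; apply/negP => H.
have zE : expR (- (- ln z)) = z by rewrite opprK lnK.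
have : om <= - ln z.
  rewrite omegaE; apply: ge_inf; first by exists 0 => x [].
  by split; rewrite ?zE // oppr_ge0 ln_le0.
by apply/negP; rewrite -ltNge -ltrN2 -ltr_expR zE.
Qed.

Lemma total_load_le1 z : 0 < z -> z < expR (- om) -> total_load z <= 1.
Proof.
move=> z0 zo; have zE : expR (- (- ln z)) = z by rewrite opprK lnK.
have : om < - ln z by rewrite -ltrN2 -ltr_expR zE.
rewrite omegaE => /(inf_lt admissible_nonempty)[y [y0 y1] yz].
apply: le_trans y1; apply: total_load_le; first exact: ltW.
  by rewrite -zE ler_expR lerN2 ltW.
by rewrite expR_le1 oppr_le0.
Qed.

(** Above [expR (- omega)] the load exceeds 1, against the upper bound. Below it
the load is less than 1 and [x C] is bounded away from 1, so that its large
powers vanish, against the lower bound. *)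
Lemma total_load_cvg (x : nat -> R) :
  (\forall C \near \oo, 0 <= x C <= 1) ->
  (forall e, 0 < e -> \forall C \near \oo, total_load (x C) <= 1 + e) ->
  (forall m e, 0 < e -> \forall C \near \oo, 1 - x C ^+ m - e <= total_load (x C)) ->
  x C @[C --> \oo] --> expR (- om).
Proof.
move=> x01 up low; set xs := expR (- om).
have xs1 : xs <= 1 by rewrite expR_le1 oppr_le0 omega_ge0.
have upper d : 0 < d -> \forall C \near \oo, x C < xs + d.
  move=> d0; have [z1|z1] := leP (xs + d) 1; last first.
    near=> C; apply: le_lt_trans z1.
    by have /andP[] : 0 <= x C <= 1 by near: C.
  have z2 : 1 < total_load (xs + d) by rewrite total_load_gt1 // ltrDl.
  have e0 : 0 < (total_load (xs + d) - 1) / 2 by rewrite divr_gt0 // subr_gt0.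
  have up' := up _ e0.
  near=> C; have /andP[x0 x1] : 0 <= x C <= 1 by near: C.
  rewrite ltNge; apply/negP => zx.
  have : total_load (xs + d) <= total_load (x C).
    by apply: total_load_le => //; rewrite addr_ge0 ?expR_ge0 // ltW.
  have : total_load (x C) <= 1 + (total_load (xs + d) - 1) / 2 by near: C.
  lra.
have lower d : 0 < d -> \forall C \near \oo, xs - d < x C.
  move=> d0; have [z0|z0] := ltP (xs - d) 0.
    near=> C; apply: lt_le_trans z0 _.
    by have /andP[] : 0 <= x C <= 1 by near: C.
  set z := xs - d in z0 *.
  have Hz : total_load z < 1.
    (* The point half-way to [xs] turns the weak bound into a strict one. *)
    apply: (@lt_le_trans _ _ (total_load (xs - d / 2))).
      apply: total_load_lt => //; rewrite /z; lra.
    by apply: total_load_le1; rewrite -?/xs; rewrite /z in z0; lra.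
  have e0 : 0 < (1 - total_load z) / 3 by rewrite divr_gt0 // subr_gt0.
  have z1 : `|z| < 1 by rewrite ger0_norm // /z; lra.
  (* Below [z], the [m]-th powers are negligible for a suitable [m]. *)
  have := cvg_geometric (1 : R) z1.
  move=> /cvgr0Pnorm_lt /(_ _ e0) [m _ /(_ m (leqnn m)) /=].
  rewrite mul1r ger0_norm ?exprn_ge0 // => zm.
  have low' := low m _ e0.
  near=> C; have /andP[x0 x1] : 0 <= x C <= 1 by near: C.
  rewrite ltNge; apply/negP => zx.
  have : x C ^+ m <= z ^+ m by rewrite lerXn2r ?nnegrE.
  have : total_load (x C) <= total_load z.
    by apply: total_load_le => //; rewrite /z; lra.
  have : 1 - x C ^+ m - (1 - total_load z) / 3 <= total_load (x C) by near: C.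
  lra.
apply/cvgrPdist_lt => /= d d0; have u := upper _ d0; have v := lower _ d0.
near=> C; rewrite ltr_distlC; apply/andP; split; near: C => //.
Unshelve. all: by end_near. Qed.

End CarriedLoad.

(** * Solutions of the fixed point equations *)

Section FixedPoints.
Variables (K : nat) (A : 'I_K -> nat).
Hypothesis hK : (1 <= K)%N.
Hypothesis hA : forall k, (0 < A k)%N.
Variables (R : realType) (lambda gamma mu : 'I_K -> R).
Hypothesis hlambda : forall k, 0 < lambda k.
Hypothesis hgamma : forall k, 0 < gamma k.
Hypothesis hmu : forall k, 0 < mu k.
Variable rho : nat -> 'I_K -> R.
Hypothesis hrho : forall C : nat, (0 < C)%N ->
  fixed_point_solution A mu gamma C (fun k => lambda k * C%:R) (rho C).

Let beta C l := shift_ratio A rho C (A l).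

Lemma rho_ge0 : \forall C \near \oo, forall l, 0 <= rho C l.
Proof.
near=> C => l; have C0 : (0 < C)%N by near: C; exact: nbhs_infty_gt.
by have [] := hrho C0.
Unshelve. all: by end_near. Qed.

Lemma beta_bounds : \forall C \near \oo, forall l, 0 <= beta C l <= 1.
Proof.
have H := shift_ratio_bounds hA rho_ge0.
near=> C => l; rewrite /beta; move: (A l); by near: C.
Unshelve. all: by end_near. Qed.

Lemma fixed_pointE : \forall C \near \oo, forall l,
  rho C l / C%:R = lambda l / (mu l + gamma l - gamma l * beta C l).
Proof.
near=> C => l; have C0 : (0 < C)%N by near: C; exact: nbhs_infty_gt.
have AC : (A l <= C)%N.
  by rewrite (leq_trans (leq_bigmax l)) //; near: C; exact: nbhs_infty_ge.
have [r0 /(_ l)] := hrho C0; rewrite (blocking_probE hA r0 AC) -/(beta C l).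
have /andP[_ b1] : 0 <= beta C l <= 1 by move: l {AC}; near: C; exact: beta_bounds.
have d0 := denom_gt0 hgamma hmu l b1.
have C0' : 0 < C%:R :> R by rewrite ltr0n.
move=> /= E; apply/eqP; rewrite eqr_div ?(gt_eqF C0') ?(gt_eqF d0) // E; apply/eqP.
rewrite /beta /shift_ratio; ring.
Unshelve. all: by end_near. Qed.

Lemma rho_linear_upper : exists2 c, 1 <= c &
  \forall C \near \oo, forall l, rho C l <= c * C%:R.
Proof.
exists (1 + \sum_(l < K) lambda l / mu l).
  by rewrite lerDl sumr_ge0 // => l _; rewrite divr_ge0 // ltW.
near=> C => l; have C0 : 0 < C%:R :> R by rewrite ltr0n; near: C; exact: nbhs_infty_gt.
have -> : rho C l = rho C l / C%:R * C%:R by rewrite divfK // gt_eqF.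
rewrite ler_wpM2r ?(ltW C0) //.
have -> : rho C l / C%:R = lambda l / (mu l + gamma l - gamma l * beta C l).
  by move: l; near: C; exact: fixed_pointE.
have /andP[_ b1] : 0 <= beta C l <= 1 by move: l; near: C; exact: beta_bounds.
rewrite (bigD1 l) //= addrCA ler_wpDr //.
  by rewrite addr_ge0 // sumr_ge0 // => i _; rewrite divr_ge0 // ltW.
rewrite ler_wpM2l ?(ltW (hlambda l)) // lef_pV2 ?posrE ?denom_gt0 //.
exact: denom_ge_mu.
Unshelve. all: by end_near. Qed.

Lemma rho_linear_lower : exists2 c, 0 < c &
  \forall C \near \oo, forall l, c * C%:R <= rho C l.
Proof.
have q0 l : 0 < lambda l / (mu l + gamma l) by rewrite divr_gt0 ?addr_gt0.
(* The inverse of a sum of inverses is a positive lower bound of all the rates. *)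
pose s : R := \sum_(l < K) (lambda l / (mu l + gamma l))^-1.
have sl l : (lambda l / (mu l + gamma l))^-1 <= s.
  rewrite /s (bigD1 l) //= lerDl sumr_ge0 // => i _.
  by rewrite invr_ge0 ltW.
have s0 : 0 < s by apply: lt_le_trans (sl (Ordinal hK)); rewrite invr_gt0.
exists s^-1; first by rewrite invr_gt0.
near=> C => l; have C0 : 0 < C%:R :> R by rewrite ltr0n; near: C; exact: nbhs_infty_gt.
rewrite -ler_pdivlMr //.
have -> : rho C l / C%:R = lambda l / (mu l + gamma l - gamma l * beta C l).
  by move: l; near: C; exact: fixed_pointE.
have /andP[b0 b1] : 0 <= beta C l <= 1 by move: l; near: C; exact: beta_bounds.
apply: (@le_trans _ _ (lambda l / (mu l + gamma l))).
  by rewrite -[leRHS]invrK lef_pV2 ?posrE ?invr_gt0.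
rewrite ler_wpM2l ?(ltW (hlambda l)) // lef_pV2 ?posrE ?denom_gt0 ?addr_gt0 //.
by rewrite gerBl mulr_ge0 // ltW.
Unshelve. all: by end_near. Qed.

Lemma shift_ratio_beta l m :
  shift_ratio A rho C (m * A l) - beta C l ^+ m @[C --> \oo] --> 0.
Proof.
have [c c1 rle] := rho_linear_upper; have [c0 c00 rge] := rho_linear_lower.
exact: (shift_ratio_power hA rho_ge0 c1 rle c00 rge).
Qed.

(** Both terms approximate the ratio for a shift by [A k * A l], seen as [A k] calls
of class [l] or as [A l] calls of class [k]. *)
Lemma beta_compatible k l :
  beta C l ^+ A k - beta C k ^+ A l @[C --> \oo] --> 0.
Proof.
have H1 := shift_ratio_beta l (A k); have H2 := shift_ratio_beta k (A l).
apply: (@near_eq_cvgn _ (fun C =>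
  (shift_ratio A rho C (A l * A k) - beta C k ^+ A l) -
  (shift_ratio A rho C (A k * A l) - beta C l ^+ A k))).
  by apply: nearW => C; rewrite mulnC; ring.
by rewrite -[X in _ --> X]subr0; exact: cvgB.
Qed.

Lemma occupancy_load C : (forall l, A l <= C)%N -> (0 < C)%N ->
  (forall l, rho C l / C%:R = lambda l / (mu l + gamma l - gamma l * beta C l)) ->
  \sum_(l < K) class_load A lambda gamma mu l (beta C l) =
  (\sum_(n <- states A C) (load A n)%:R * weight (rho C) n) /
    (C%:R * partition_sum A (rho C) C).
Proof.
move=> AC C0 E; have [r0 _] := hrho C0.
rewrite mean_loadE // mulr_suml; apply: eq_bigr => l _.
have -> : class_load A lambda gamma mu l (beta C l) =
    (A l)%:R * (rho C l / C%:R) * beta C l by rewrite E /class_load; ring.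
rewrite /beta /shift_ratio.
have S0 := partition_sum_gt0 hA r0 C.
have C0' : 0 < C%:R :> R by rewrite ltr0n.
by field; rewrite !gt_eqF.
Qed.

Section Root.
Variable k : 'I_K.

(** Class [k] serves as the reference from which the common parameter is read off. *)
Let x C := beta C k `^ (A k)%:R^-1.

Lemma root_bounds : \forall C \near \oo, 0 <= x C <= 1.
Proof.
near=> C; have /andP[b0 b1] : 0 <= beta C k <= 1.
  by move: (k); near: C; exact: beta_bounds.
rewrite powR_ge0 /= -(@expr_le1 _ (A k)) ?powR_ge0 // -powR_mulrn ?powR_ge0 //.
by rewrite -powRrM mulVf ?powRr1 // pnatr_eq0 -lt0n.
Unshelve. all: by end_near. Qed.

Lemma rootK : \forall C \near \oo, x C ^+ A k = beta C k.
Proof.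
near=> C; have /andP[b0 b1] : 0 <= beta C k <= 1.
  by move: (k); near: C; exact: beta_bounds.
rewrite -powR_mulrn ?powR_ge0 //.
by rewrite -powRrM mulVf ?powRr1 // pnatr_eq0 -lt0n.
Unshelve. all: by end_near. Qed.

Lemma beta_root l : beta C l - x C ^+ A l @[C --> \oo] --> 0.
Proof.
apply: (cvg0_of_exprn (hA k)).
apply: (@norm_le_cvg0 _ _ (fun C => `|beta C l ^+ A k - beta C k ^+ A l|)).
  near=> C; have /andP[x0 x1] : 0 <= x C <= 1 by near: C; exact: root_bounds.
  have /andP[b0 b1] : 0 <= beta C l <= 1 by move: (l); near: C; exact: beta_bounds.
  have <- : x C ^+ A k = beta C k by near: C; exact: rootK.
  (* The [A l]-th power of [beta C k] is the [A k]-th power of [x C ^+ A l]. *)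
  rewrite ger0_norm ?exprn_ge0 // exprAC.
  by apply: exprn_dist_le; rewrite ?exprn_ge0.
by rewrite -[X in _ --> X](@normr0 _ R); apply: cvg_norm; apply: beta_compatible.
Unshelve. all: by end_near. Qed.

Let G C := \sum_(l < K) class_load A lambda gamma mu l (beta C l).
Let Phi := total_load A lambda gamma mu.

Lemma load_root : G C - Phi (x C) @[C --> \oo] --> 0.
Proof.
pose L l := lambda l * (A l)%:R * (mu l + gamma l) / mu l ^+ 2.
apply: (@norm_le_cvg0 _ _ (fun C => \sum_(l < K) L l * `|beta C l - x C ^+ A l|)).
  near=> C; have /andP[x0 x1] : 0 <= x C <= 1 by near: C; exact: root_bounds.
  rewrite /G /Phi /total_load -sumrB (le_trans (ler_norm_sum _ _ _)) //.
  apply: ler_sum => l _; apply: class_load_lipschitz => //.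
    by rewrite exprn_ile1.
  have /andP[] // : 0 <= beta C l <= 1 by move: (l); near: C; exact: beta_bounds.
rewrite -[X in _ --> X](_ : \sum_(l < K) L l * 0 = 0); last first.
  by rewrite big1 // => l _; rewrite mulr0.
apply: cvg_sumr => l.
apply: cvgM; first exact: cvg_cst.
by rewrite -[X in _ --> X](@normr0 _ R); apply: cvg_norm; apply: beta_root.
Unshelve. all: by end_near. Qed.

(** The lower bound weakens [(1 - L / C) * (1 - shift_ratio L)], which
[mean_load_ge] provides. *)
Lemma load_bounds L : \forall C \near \oo,
  1 - shift_ratio A rho C L - L%:R / C%:R <= G C <= 1.
Proof.
have bounds := shift_ratio_bounds hA rho_ge0.
near=> C.
have C0 : (0 < C)%N by near: C; exact: nbhs_infty_gt.
have [r0 _] := hrho C0.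
have LC : (L <= C)%N by near: C; exact: nbhs_infty_ge.
have AC l : (A l <= C)%N.
  by rewrite (leq_trans (leq_bigmax l)) //; near: C; exact: nbhs_infty_ge.
have S0 := partition_sum_gt0 hA r0 C.
have C0' : 0 < C%:R :> R by rewrite ltr0n.
have -> : G C = _ := occupancy_load AC C0 _; last first.
  by near: C; exact: fixed_pointE.
have CS : 0 < C%:R * partition_sum A (rho C) C by rewrite mulr_gt0.
apply/andP; split; last by rewrite ler_pdivrMr // mul1r mean_load_le.
rewrite ler_pdivlMr //; apply: le_trans (mean_load_ge hA r0 LC).
have : 0 <= shift_ratio A rho C L.
  have /(_ L)/andP[] // : forall L, 0 <= shift_ratio A rho C L <= 1.
  by near: C.
rewrite natrB // /shift_ratio.
set s := partition_sum _ _ (C - L); move: (partition_sum _ _ C) S0 => t t0 st.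
rewrite -subr_ge0 (_ : _ - _ = L%:R * t * (s / t)); last by field; rewrite !gt_eqF.
by apply: mulr_ge0 => //; rewrite mulr_ge0 // ltW.
Unshelve. all: by end_near. Qed.

(** The lower bound on the load is used with [L = m * A k]: then the shift ratio is
close to [x C ^+ (m * A k)]. *)
Lemma root_cvg : x C @[C --> \oo] --> expR (- omega A lambda mu gamma).
Proof.
apply: total_load_cvg => //; first exact: root_bounds.
  move=> e e0; move/cvgr0Pnorm_le/(_ _ e0): load_root => H.
  near=> C; have /andP[_ G1] : 1 - shift_ratio A rho C 0 - 0%:R / C%:R <= G C <= 1.
    by near: C; exact: load_bounds.
  have : `|G C - Phi (x C)| <= e by near: C.
  by rewrite ler_norml /Phi => /andP[]; lra.
move=> m e e0; pose L := (m * A k)%N.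
have e3 : 0 < e / 3 by rewrite divr_gt0.
move/cvgr0Pnorm_le/(_ _ e3): load_root => H1.
move/cvgr0Pnorm_le/(_ _ e3): (shift_ratio_beta k m) => H2.
move/cvgr0Pnorm_le/(_ _ e3): (cvg_inv_nat (L%:R : R)) => H3.
near=> C.
have /andP[G1 _] : 1 - shift_ratio A rho C L - L%:R / C%:R <= G C <= 1.
  by near: C; exact: load_bounds.
have /andP[x0 x1] : 0 <= x C <= 1 by near: C; exact: root_bounds.
have xk : x C ^+ A k = beta C k by near: C; exact: rootK.
have xm : beta C k ^+ m <= x C ^+ m.
  by rewrite lerXn2r ?nnegrE -?xk ?exprn_ge0 // -[leRHS]expr1 ler_wiXn2l.
have : `|G C - Phi (x C)| <= e / 3 by near: C.
have : `|shift_ratio A rho C L - beta C k ^+ m| <= e / 3 by near: C.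
have : `|L%:R / C%:R| <= e / 3 by near: C.
rewrite !ler_norml /Phi => /andP[_ h1] /andP[_ h2] /andP[_ h3].
lra.
Unshelve. all: by end_near. Qed.

End Root.
End FixedPoints.

Theorem theorem2 (R : realType) (K : nat) (hK : (1 <= K)%N)
  (A : 'I_K -> nat) (hA : forall k, (0 < A k)%N)
  (lambda gamma mu : 'I_K -> R)
  (hlambda : forall k, 0 < lambda k)
  (hgamma : forall k, 0 < gamma k)
  (hmu : forall k, 0 < mu k)
  (rho : nat -> 'I_K -> R)
  (hrho : forall C : nat, (0 < C)%N ->
     fixed_point_solution A mu gamma C (fun k => lambda k * C%:R) (rho C))
  (k : 'I_K) :
  (rho C k / C%:R) @[C --> \oo] -->
    lambda k / (mu k + gamma k
      - gamma k * expR (- (omega A lambda mu gamma * (A k)%:R))).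
Proof.
pose x C := shift_ratio A rho C (A k) `^ (A k)%:R^-1.
have xcvg := root_cvg hK hA hlambda hgamma hmu hrho k.
have -> : expR (- (omega A lambda mu gamma * (A k)%:R)) =
    expR (- omega A lambda mu gamma) ^+ A k.
  by rewrite -expRM_natl mulrN mulrC.
have y1 : expR (- omega A lambda mu gamma) ^+ A k <= 1.
  by rewrite exprn_ile1 ?expR_ge0 // expR_le1 oppr_le0 omega_ge0.
have : lambda k / (mu k + gamma k - gamma k * x C ^+ A k) @[C --> \oo] -->
    lambda k / (mu k + gamma k -
      gamma k * expR (- omega A lambda mu gamma) ^+ A k).
  apply: cvgM; first exact: cvg_cst.
  apply: cvgV; first by rewrite gt_eqF ?denom_gt0.
  apply: cvgB; first exact: cvg_cst.
  by apply: cvgM; [exact: cvg_cst | exact: cvg_exprn].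
apply: near_eq_cvgn.
near=> C.
have -> : x C ^+ A k = shift_ratio A rho C (A k).
  by near: C; exact: (rootK hA hrho).
have fpE : forall l, rho C l / C%:R =
    lambda l / (mu l + gamma l - gamma l * shift_ratio A rho C (A l)).
  by near: C; exact: (fixed_pointE hA hgamma hmu hrho).
by rewrite fpE.
Unshelve. all: by end_near. Qed.
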